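(* Let $\bar Z\in\mathbb{R}^{n_p\times n_p}$ satisfy the feasibility condition $$Z^T\big[I+\tfrac12(D_u+D_u^T)\big]Z-\tfrac12Z^T-\tfrac12Z\preceq0\qquad(\star)$$ (with $Z=\bar Z$), and assume that all eigenvalues of $\bar A\triangleq A-B_u\bar ZC_v$ lie in the open unit disk. Let $\bar J(\bar Z)$ be the stationary performance obtained with $Z_k=\bar Z$ for all $k$, and let $\phi$ be the function associated with $\bar Z$ in the context. Consider the full-state feedback law $\mathcal{K}:x_k\mapsto Z_k$ in which, at each time $k$, $Z_k$ is a minimizer of $Z\mapsto\phi(x_k,Z)$ over all $Z\in\mathbb{R}^{n_p\times n_p}$ satisfying $(\star)$. Then $\phi(x_k,Z_k)\le0$ for all $k\in\mathbb{Z}$, and, in stationarity, the performance $J=\mathcal{E}\{\|y_k-y^\star\|_2^2\}$ of this controller satisfies $$J\le\bar J(\bar Z).$$ In particular, if $\bar Z=\bar Z^\circ$ is a minimizer of $\bar J(\cdot)$ over all static gains $Z\in\mathbb{R}^{n_p\times n_p}$ satisfying $(\star)$ for which all eigenvalues of $A-B_uZC_v$ lie in the open unit disk, then the resulting controller satisfies $J\le\bar J(\bar Z^\circ)$, i.e. it performs no worse than the optimized static controller.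
   Context: Plant. Consider the discrete-time linear time-invariant system $$x_{k+1}=Ax_k+B_uu_k+B_ww_k,\qquad v_k=C_vx_k+D_uu_k+D_ww_k,\qquad y_k=C_yx_k,\qquad k\in\mathbb{Z},$$ with real matrices, state $x_k\in\mathbb{R}^n$, control input $u_k\in\mathbb{R}^{n_p}$, colocated output $v_k\in\mathbb{R}^{n_p}$, tracking output $y_k\in\mathbb{R}^{n_y}$, and disturbance $w_k\in\mathbb{R}^{n_w}$. The sequence $(w_k)$ is independent and identically distributed with mean $\mu_w$ and covariance matrix $S_w=S_w^T\succ0$ (no further distributional assumption). The map $u\mapsto v$ is passive, so that the transfer function $H_{uv}(z)=D_u+C_v[zI-A]^{-1}B_u$ is positive-real (analytic in $|z|>1$ with $H_{uv}(z)+H_{uv}(z)^*\succeq0$ there; in particular $D_u+D_u^T\succeq0$). The vector $y^\star\in\mathbb{R}^{n_y}$ is a constant reference. Control. The input is parametrized by a matrix $Z_k\in\mathbb{R}^{n_p\times n_p}$ as $u_k=-Z_k(C_vx_k+D_ww_k)$, so $$x_{k+1}=[A-B_uZ_kC_v]x_k+[B_w-B_uZ_kD_w]w_k .$$ Here $\preceq$ and $\succeq$ denote the order on symmetric matrices, and $X^{-T}=(X^{-1})^T$. Stationarity. $\mathcal{E}\{\cdot\}$ denotes expectation in stationarity: the feedback law is a measurable function of $x_k$, $w_k$ is independent of $(x_\ell)_{\ell\le k}$, and the closed-loop process $(x_k,Z_k)$ is assumed to be stationary (its distribution does not depend on $k$) with $x_k$ having finite second moments. Static performance. For a gain $\bar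 Z$ with $\bar A=A-B_u\bar ZC_v$ having all eigenvalues in the open unit disk, put $M=B_w-B_u\bar ZD_w$, $\bar\mu_x=[I-\bar A]^{-1}M\mu_w$, and let $\bar S_x$ be the solution of $\bar S_x=\bar A\bar S_x\bar A^T+MS_wM^T$. Then $\bar J(\bar Z)=\operatorname{tr}\{C_y\bar S_xC_y^T\}+\|C_y\bar\mu_x-y^\star\|_2^2$. The function $\phi$. Let $P=P^T\succeq0$ be the unique solution of $0=\bar A^TP\bar A-P+C_y^TC_y$, and set $$L=[\bar A-I]^{-T}C_y^T[y^\star-C_y\bar\mu_x],\quad F=B_u^TP\bar A,\quad R=B_u^TPB_u,\quad G=B_u^TPMS_wD_w^T,\quad W=D_wS_wD_w^T.$$ For $x\in\mathbb{R}^n$ and $Z\in\mathbb{R}^{n_p\times n_p}$, with $r=F(x-\bar\mu_x)+B_u^TL$, $q=C_vx+D_w\mu_w$ and $\Delta Z=Z-\bar Z$, $$\phi(x,Z)=q^T\Delta Z^TR\,\Delta Z\,q-2r^T\Delta Z\,q+\operatorname{tr}\!\big(W\Delta Z^TR\,\Delta Z-2G^T\Delta Z\big).$$ *)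

(* Defs.v *)
From HB Require Import structures.
From mathcomp Require Import all_boot all_order all_algebra.
From mathcomp Require Import complex.
From mathcomp Require Import all_classical all_reals all_analysis.

Set Implicit Arguments.
Unset Strict Implicit.
Unset Printing Implicit Defensive.

Import Order.TTheory GRing.Theory Num.Theory.
Import numFieldNormedType.Exports.

Local Open Scope classical_set_scope.
Local Open Scope ring_scope.

Definition psdmx (R : realType) (n : nat) (A : 'M[R]_n) : Prop :=
  A^T = A /\ forall u : 'cV[R]_n, 0 <= (u^T *m A *m u) 0 0.

Definition pdmx (R : realType) (n : nat) (A : 'M[R]_n) : Prop :=
  A^T = A /\ forall u : 'cV[R]_n, u != 0 -> 0 < (u^T *m A *m u) 0 0.

Definition lemx (R : realType) (n : nat) (A B : 'M[R]_n) : Prop :=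
  psdmx (B - A).

(* In the order of R[i], 0 <= z forces z to be real; over the complex field
   this already makes A Hermitian. *)
Definition cpsdmx (R : realType) (n : nat) (A : 'M[R[i]]_n) : Prop :=
  forall u : 'cV[R[i]]_n, 0 <= ((map_mx Num.conj u)^T *m A *m u) 0 0.

Definition cplxmx (R : realType) (m n : nat) (A : 'M[R]_(m, n)) :
  'M[R[i]]_(m, n) := map_mx (real_complex R) A.

Definition schur_stable (R : realType) (n : nat) (A : 'M[R]_n) : Prop :=
  forall z : R[i], eigenvalue (cplxmx A) z -> `|z| < 1.

Definition sqnorm2 (R : realType) (m : nat) (v : 'cV[R]_m) : R :=
  \sum_(i < m) v i 0 ^+ 2.

(* x_{k+1} = A x_k + Bu u_k + Bw w_k,  v_k = Cv x_k + Du u_k + Dw w_k,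
   y_k = Cy x_k. *)
Record plant (R : realType) (n np nw ny : nat) := Plant {
  mxA : 'M[R]_n;
  mxBu : 'M[R]_(n, np);
  mxBw : 'M[R]_(n, nw);
  mxCv : 'M[R]_(np, n);
  mxDu : 'M[R]_np;
  mxDw : 'M[R]_(np, nw);
  mxCy : 'M[R]_(ny, n)
}.

Section Plant.
Context (R : realType) (n np nw ny : nat) (S : plant R n np nw ny).

Local Notation A := (mxA S).
Local Notation Bu := (mxBu S).
Local Notation Bw := (mxBw S).
Local Notation Cv := (mxCv S).
Local Notation Du := (mxDu S).
Local Notation Dw := (mxDw S).
Local Notation Cy := (mxCy S).

Definition transfer (z : R[i]) : 'M[R[i]]_np :=
  cplxmx Du + cplxmx Cv *m invmx (z%:M - cplxmx A) *m cplxmx Bu.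

(* A may have eigenvalues outside the closed unit disk that cancel in the
   transfer function, so H is its extension over these removable
   singularities. The derivative in H is the complex one, hence
   differentiability on the open set 1 < |z| is analyticity there. *)
Definition positive_real : Prop :=
  exists H : R[i] -> 'M[R[i]]_np,
  [/\ forall z, 1 < `|z| -> z%:M - cplxmx A \in unitmx -> H z = transfer z,
      forall z i j, 1 < `|z| -> derivable (fun s : R[i]^o => H s i j : R[i]^o) z 1
    & forall z, 1 < `|z| -> cpsdmx (H z + (map_mx Num.conj (H z))^T)].

Definition feasible (Z : 'M[R]_np) : Prop :=
  lemx (Z^T *m (1%:M + 2^-1 *: (Du + Du^T)) *m Z - 2^-1 *: Z^T - 2^-1 *: Z) 0.

Definition input (Z : 'M[R]_np) (x : 'cV[R]_n) (w : 'cV[R]_nw) : 'cV[R]_np :=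
  - (Z *m (Cv *m x + Dw *m w)).

Definition next_state (x : 'cV[R]_n) (u : 'cV[R]_np) (w : 'cV[R]_nw) :
  'cV[R]_n := A *m x + Bu *m u + Bw *m w.

Section Static.
Variables (muw : 'cV[R]_nw) (Sw : 'M[R]_nw) (ystar : 'cV[R]_ny).
Variable Zbar : 'M[R]_np.

Definition Abar : 'M[R]_n := A - Bu *m Zbar *m Cv.

Definition Mbar : 'M[R]_(n, nw) := Bw - Bu *m Zbar *m Dw.

Definition mux : 'cV[R]_n := invmx (1%:M - Abar) *m Mbar *m muw.

(* When Abar is Schur stable, the solutions picked in Sx and Pbar exist and are
   unique; otherwise these matrices are not meaningful. *)
Definition Sx : 'M[R]_n :=
  xget 0 [set X | X = Abar *m X *m Abar^T + Mbar *m Sw *m Mbar^T].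

Definition static_perf : R :=
  \tr (Cy *m Sx *m Cy^T) + sqnorm2 (Cy *m mux - ystar).

Definition Pbar : 'M[R]_n :=
  xget 0 [set X | psdmx X /\ 0 = Abar^T *m X *m Abar - X + Cy^T *m Cy].

Definition Lbar : 'cV[R]_n :=
  (invmx (Abar - 1%:M))^T *m Cy^T *m (ystar - Cy *m mux).

Definition Fbar : 'M[R]_(np, n) := Bu^T *m Pbar *m Abar.

Definition Rbar : 'M[R]_np := Bu^T *m Pbar *m Bu.

Definition Gbar : 'M[R]_np := Bu^T *m Pbar *m Mbar *m Sw *m Dw^T.

Definition Wbar : 'M[R]_np := Dw *m Sw *m Dw^T.

Definition phi (x : 'cV[R]_n) (Z : 'M[R]_np) : R :=
  let r := Fbar *m (x - mux) + Bu^T *m Lbar in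
  let q := Cv *m x + Dw *m muw in
  let dZ := Z - Zbar in
  (q^T *m dZ^T *m Rbar *m dZ *m q) 0 0 - 2 * (r^T *m dZ *m q) 0 0
  + \tr (Wbar *m dZ^T *m Rbar *m dZ - 2 *: (Gbar^T *m dZ)).

End Static.

Definition static_optimal (muw : 'cV[R]_nw) (Sw : 'M[R]_nw)
    (ystar : 'cV[R]_ny) (Zo : 'M[R]_np) : Prop :=
  [/\ feasible Zo, schur_stable (Abar Zo)
    & forall Z, feasible Z -> schur_stable (Abar Z) ->
        static_perf muw Sw ystar Zo <= static_perf muw Sw ystar Z].

End Plant.

Definition minimizes (R : realType) (T : Type) (f : T -> R) (D : T -> Prop)
    (a : T) : Prop :=
  D a /\ forall b, D b -> f a <= f b.

(* Matrices carry the Borel sigma-algebra, generated by the entries as the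
   library does for tuples. *)

Definition measure_matrix_display : measure_display -> measure_display.
Proof. exact. Qed.

Section measurable_matrix.
Context (R : realType) (m n : nat).

Definition mx_measurable : set (set 'M[R]_(m, n)) :=
  <<s \bigcup_(ij in [set: 'I_m * 'I_n])
        preimage_set_system setT (fun A : 'M[R]_(m, n) => A ij.1 ij.2)
          measurable >>.

Let mx_measurable0 : mx_measurable set0.
Proof. exact: sigma_algebra0. Qed.

Let mx_measurableC B : mx_measurable B -> mx_measurable (~` B).
Proof. exact: sigma_algebraC. Qed.

Let mx_measurable_bigcup (F : (set 'M[R]_(m, n))^nat) :
  (forall i, mx_measurable (F i)) -> mx_measurable (\bigcup_i F i).
Proof. exact: sigma_algebra_bigcup. Qed.

HB.instance Definition _ := @isMeasurable.Build
  (measure_matrix_display default_measure_display) 'M[R]_(m, n)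
  mx_measurable mx_measurable0 mx_measurableC mx_measurable_bigcup.

End measurable_matrix.

Section Processes.
Context (R : realType) (d : measure_display) (T : measurableType d).
Variable P : probability T R.

Definition square_integrable (m : nat) (X : {RV P >-> 'cV[R]_m}) : Prop :=
  forall i, (fun t => X t i 0) \in Lfun P 2%:E.

Definition has_mean_cov (m : nat) (X : {RV P >-> 'cV[R]_m}) (mu : 'cV[R]_m)
    (S : 'M[R]_m) : Prop :=
  [/\ square_integrable X,
      forall i, ('E_P[fun t => (X t i 0)%R])%E = (mu i 0)%:E
    & forall i j,
        covariance P (fun t => X t i 0) (fun t => X t j 0) = (S i j)%:E].

Definition iid (m : nat) (w : int -> {RV P >-> 'cV[R]_m}) : Prop :=
  (forall k l B, measurable B -> distribution P (w k) B = distribution P (w l) B)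
  /\ forall (s : seq int) (B : int -> set 'cV[R]_m),
       uniq s -> (forall k, measurable (B k)) ->
       P (\bigcap_(k in [set` s]) (w k @^-1` B k))
       = (\prod_(k <- s) P (w k @^-1` B k))%E.

Definition past (m : nat) (x : int -> {RV P >-> 'cV[R]_m}) (k : int) :
    set (set T) :=
  <<s \bigcup_(l in [set l | (l <= k)%R])
        preimage_set_system setT (x l) measurable >>.

Definition indep_of_past (m p : nat) (w : int -> {RV P >-> 'cV[R]_p})
    (x : int -> {RV P >-> 'cV[R]_m}) : Prop :=
  forall k E B, past x k E -> measurable B ->
    P (E `&` w k @^-1` B) = (P E * P (w k @^-1` B))%E.

(* The law of (x_k, Z_k), Z_k = K x_k, on the product space is the same for all
   k. *)
Definition stationary_loop (n p : nat) (x : int -> {RV P >-> 'cV[R]_n})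
    (K : {mfun 'cV[R]_n >-> 'M[R]_p}) : Prop :=
  forall (k l : int) (E : set ('cV[R]_n * 'M[R]_p)), measurable E ->
    P [set t | E (x k t, K (x k t))] = P [set t | E (x l t, K (x l t))].

End Processes.

(* Main.v *)
(** Put e = x - mux and V(x) = e^T P e + 2 L^T e. Substituting the closed loop
    and averaging over the noise only, the equations defining P and L turn the
    one-step drift into
      E[V(x_{k+1}) | x_k] - V(x_k)
        = - |y_k - y*|^2 + Jbar(Zbar) + phi(x_k, Z_k),
    where tr(P M Sw M^T) = tr(Cy Sx Cy^T) by duality of the two Lyapunov
    equations. Stationarity cancels the expectations of V, and
    phi(x_k, Z_k) <= 0 because Zbar is feasible with phi(x, Zbar) = 0.

    Integrability of the noise terms is never needed separately: V(x_{k+1}) is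
    integrable because x_{k+1} is square integrable, and the averaging over the
    noise is Fubini's theorem for the product law of (x_k, w_k). *)

Require Import Defs.
From HB Require Import structures.
From mathcomp Require Import all_boot all_order all_algebra.
From mathcomp Require Import complex.
From mathcomp Require Import all_classical all_reals all_analysis.
From mathcomp Require Import measurable_realfun ring lra.
Import Order.TTheory GRing.Theory Num.Theory.
Import numFieldNormedType.Exports.
Local Open Scope classical_set_scope.
Local Open Scope ring_scope.

Set Implicit Arguments.
Unset Strict Implicit.
Unset Printing Implicit Defensive.

(** * Geometric decay of the powers of a Schur stable matrix *)

Lemma geometric_bound_recurrence (R : realFieldType) (a : nat -> R)
    (l c rho : R) : 0 <= l < 1 -> 0 <= c -> 0 <= rho < 1 ->
  (forall k, 0 <= a k) -> (forall k, a k.+1 <= l * a k + c * rho ^+ k) ->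
  exists c' rho', [/\ 0 <= c', 0 <= rho' < 1 & forall k, a k <= c' * rho' ^+ k].
Proof.
move=> /andP[l0 l1] c0 /andP[r0 r1] a0 rec.
(* A rate strictly above [l] also covers the resonant case [l = rho], where the exact solution
   carries a factor k. *)
pose rho' := 1 - (1 - rho) * (1 - l) / 2.
have lr : l < rho' by rewrite /rho'; nra.
have rr : rho <= rho' by rewrite /rho'; nra.
have r'1 : rho' < 1 by rewrite /rho'; nra.
(* C = c / (rho' - l) solves l C + c = C rho', so C rho'^k absorbs the forcing term; adding [a 0]
   covers the initial value. *)
exists (a 0%N + c / (rho' - l)), rho'.
have d0 : 0 < rho' - l by rewrite subr_gt0.
have e0 : 0 <= c / (rho' - l) by rewrite divr_ge0 // ltW.
have ec : c / (rho' - l) * (rho' - l) = c by rewrite mulfVK // gt_eqF.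
split; first exact: addr_ge0.
  by rewrite r'1 andbT; lra.
elim=> [|k IH]; first by rewrite expr0 mulr1 lerDl.
apply: le_trans (rec k) _; rewrite exprS.
have p0 : 0 <= rho' ^+ k by rewrite exprn_ge0 //; lra.
have cp : c * rho ^+ k <= c * rho' ^+ k.
  by rewrite ler_wpM2l // lerXn2r // nnegrE; lra.
have lp := ler_wpM2l l0 IH.
have ap : 0 <= a 0%N * (rho' - l) * rho' ^+ k.
  by rewrite !mulr_ge0 //; lra.
have -> : (a 0%N + c / (rho' - l)) * (rho' * rho' ^+ k) =
   l * ((a 0%N + c / (rho' - l)) * rho' ^+ k) + c * rho' ^+ k
   + a 0%N * (rho' - l) * rho' ^+ k.
  by rewrite -{3}ec; ring.
lra.
Qed.

(* Cayley-Hamilton makes B = 1 annihilated by the product over all eigenvalues;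
   each factor 'X - z is peeled off by the first-order recurrence
   B A^(k+1) = z B A^k + (B (A - z)) A^k. *)
Lemma mulmx_expr_geometric (R : realType) n m (A : 'M[R[i]]_n.+1) (s : seq R[i])
    (B : 'M[R[i]]_(m, n.+1)) :
  (forall z, z \in s -> `|z| < 1) ->
  B *m horner_mx A (\prod_(z <- s) ('X - z%:P)) = 0 ->
  forall i j, exists c rho, [/\ 0 <= c, 0 <= rho < 1
    & forall k, Normc.normc ((B *m (A ^+ k)) i j) <= c * rho ^+ k].
Proof.
elim: s B => [|z s IH] B s1.
  rewrite big_nil rmorph1 mulmx1 => -> i j.
  exists 0, 0; split=> //; first by rewrite lexx ltr01.
  by move=> k; rewrite mul0mx mxE Normc.normc0 mul0r.
rewrite big_cons rmorphM /= rmorphB /= horner_mx_X horner_mx_C -mulmxE mulmxA.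
move=> /IH {}IH i j.
have /IH/(_ i j)[c [rho [c0 r01 bd]]] : forall z, z \in s -> `|z| < 1.
  by move=> y ys; apply: s1; rewrite inE ys orbT.
have z1 : `|z| < 1 by apply: s1; rewrite mem_head.
apply: (@geometric_bound_recurrence _ _ (Normc.normc z) c rho) => //.
- apply/andP; split; last by rewrite -ltcR.
  by rewrite -lecR; exact: (normr_ge0 z).
- by move=> k; rewrite -lecR; exact: (normr_ge0 ((B *m A ^+ k) i j)).
move=> k; have -> : (B *m A ^+ k.+1) i j =
    z * (B *m A ^+ k) i j + (B *m (A - z%:M) *m A ^+ k) i j.
  rewrite exprS -mulmxE mulmxBr mul_mx_scalar mulmxBl -scalemxAl mulmxA.
  by rewrite [X in _ = _ + X]mxE [X in _ = _ + (_ + X)]mxE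
    [X in _ = _ + (_ - X)]mxE addrC subrK.
apply: le_trans (le_normcD _ _) _.
by rewrite Normc.normcM lerD2l.
Qed.

Definition cvg_entries (R : realType) m n (F : nat -> 'M[R]_(m, n))
    (M : 'M[R]_(m, n)) :=
  forall i j, (fun k => F k i j) @ \oo --> M i j.

Section CvgEntries.
Variable R : realType.

Lemma cvg_entries_cst m n (M : 'M[R]_(m, n)) : cvg_entries (fun=> M) M.
Proof. by move=> i j; exact: cvg_cst. Qed.

Lemma cvg_entries_tr m n (F : nat -> 'M[R]_(m, n)) M :
  cvg_entries F M -> cvg_entries (fun k => (F k)^T) M^T.
Proof.
by move=> FM i j; rewrite mxE; under eq_fun do rewrite mxE; exact: FM.
Qed.

Lemma cvg_entries_mul m n p (F : nat -> 'M[R]_(m, n)) (G : nat -> 'M[R]_(n, p))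
    M N : cvg_entries F M -> cvg_entries G N ->
  cvg_entries (fun k => F k *m G k) (M *m N).
Proof.
move=> FM GN i j; rewrite mxE; under eq_fun do rewrite mxE.
apply: (cvg_big (op := +%R)) => [|l _]; first exact: add_continuous.
by apply: cvgM; [exact: FM | exact: GN].
Qed.

Lemma cvg_entries_unique m n (F : nat -> 'M[R]_(m, n)) M N :
  cvg_entries F M -> cvg_entries F N -> M = N.
Proof.
move=> FM FN; apply/matrixP => i j.
by apply: (@cvg_unique _ (@norm_hausdorff _ R) _ _ _ _ (FM i j) (FN i j)).
Qed.

End CvgEntries.

(** The real, eigenvalue-free form of stability on which the Lyapunov arguments run. *)
Definition powers_vanish (R : realType) n (A : 'M[R]_n) :=
  cvg_entries (fun k => A ^+ k) 0.

(** Over R[i] the characteristic polynomial splits with the eigenvalues as roots. By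
    Cayley-Hamilton, [mulmx_expr_geometric] with B = 1 bounds each entry of A^k by a geometric
    sequence. *)
Lemma schur_stable_powers_vanish (R : realType) n (A : 'M[R]_n) :
  schur_stable A -> powers_vanish A.
Proof.
case: n A => [|n] A sA; first by move=> [].
move=> i j; rewrite [X in _ --> X]mxE.
have [s Es] := closed_field_poly_normal (char_poly (cplxmx A)).
move: Es; rewrite (monicP (char_poly_monic _)) scale1r => Es.
have s1 z : z \in s -> `|z| < 1.
  move=> zs; apply: sA; rewrite eigenvalue_root_char Es root_prod_XsubC //.
have H0 : 1%:M *m horner_mx (cplxmx A) (\prod_(z <- s) ('X - z%:P)) = 0.
  by rewrite -Es Cayley_Hamilton mulmx0.
have [c [rho [c0 /andP[r0 r1] bd]]] := mulmx_expr_geometric s1 H0 i j.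
have bdA k : `|(A ^+ k) i j| <= c * rho ^+ k.
  have := bd k; 
  have -> : cplxmx A ^+ k = cplxmx (A ^+ k).
    by rewrite /cplxmx rmorphXn.
  rewrite mul1mx mxE; apply: le_trans.
  by rewrite /Normc.normc /= expr0n addr0 sqrtr_sqr.
apply: norm_cvg0.
apply: (@squeeze_cvgr _ _ _ _ (fun=> 0) (geometric c rho)).
- by near=> k; rewrite normr_ge0 bdA.
- exact: cvg_cst.
- by apply: cvg_geometric; rewrite ger0_norm.
Unshelve. all: by end_near.
Qed.

(** Gives access to the dual Lyapunov equation, that of [Sx]. *)
Lemma powers_vanish_tr (R : realType) n (A : 'M[R]_n) :
  powers_vanish A -> powers_vanish A^T.
Proof.
move=> vA; have E : GRing.exp A^T = (fun k => (A ^+ k)^T).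
  apply/funext; elim=> [|k IH]; rewrite ?expr0 ?trmx1 //.
  by rewrite exprS exprSr IH -!mulmxE trmx_mul.
by rewrite /powers_vanish E -[0]trmx0; exact: cvg_entries_tr.
Qed.

(** * Discrete Lyapunov equations *)

Section Lyapunov.
Variables (R : realType) (n : nat) (A : 'M[R]_n).
Hypothesis vA : powers_vanish A.

Lemma powers_vanish_congr (X : 'M[R]_n) :
  cvg_entries (fun k => (A ^+ k)^T *m X *m A ^+ k) 0.
Proof.
rewrite -[0](mulmx0 _ (0^T *m X)); apply: cvg_entries_mul vA.
by apply: cvg_entries_mul; [exact: cvg_entries_tr | exact: cvg_entries_cst].
Qed.

(** Unrolling k times leaves a remainder that vanishes as k grows; uniqueness and positivity both
    come from this limit. *)
Lemma lyapunov_iter (X Q : 'M[R]_n) k : X = A^T *m X *m A + Q ->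
  X = (A ^+ k)^T *m X *m A ^+ k + \sum_(l < k) (A ^+ l)^T *m Q *m A ^+ l.
Proof.
move=> XE; elim: k => [|k IH].
  by rewrite big_ord0 expr0 addr0 trmx1 mul1mx mulmx1.
rewrite big_ord_recr /= [in LHS]IH {1}XE exprS -!mulmxE trmx_mul.
by rewrite mulmxDr mulmxDl !mulmxA -addrA [X in _ + X]addrC.
Qed.

(** The difference D solves the homogeneous equation, so D = (A^k)^T D A^k for every k, and the
    right side tends to 0. *)
Lemma lyapunov_unique (X Y Q : 'M[R]_n) :
  X = A^T *m X *m A + Q -> Y = A^T *m Y *m A + Q -> X = Y.
Proof.
move=> XE YE; apply/eqP; rewrite -subr_eq0; apply/eqP.
have DE : X - Y = A^T *m (X - Y) *m A + 0.
  by rewrite {1}XE {1}YE mulmxBr mulmxBl addr0 opprD addrACA subrr addr0.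
apply: cvg_entries_unique (powers_vanish_congr (X - Y)).
have E k : (A ^+ k)^T *m (X - Y) *m A ^+ k = X - Y.
  rewrite [RHS](lyapunov_iter k DE) big1 ?addr0 // => l _.
  by rewrite mulmx0 mul0mx.
by under eq_fun do rewrite E; exact: cvg_entries_cst.
Qed.

(** X - A^T X A is a linear endomorphism of a finite-dimensional space: injective by uniqueness,
    hence onto. No series has to be summed. *)
Lemma lyapunov_solvable (Q : 'M[R]_n) : exists X, X = A^T *m X *m A + Q.
Proof.
(* The matrix of this endomorphism on vectorised matrices, acting on rows. *)
pose M := 1%:M - lin_mulmx A^T *m lin_mulmxr A : 'M[R]_(n * n).
have ME X : mxvec X *m M = mxvec (X - A^T *m X *m A).
  by rewrite mulmxBr mulmx1 mulmxA !mul_vec_lin linearB.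
have Mu : M \in unitmx.
  rewrite -row_free_unit -kermx_eq0; apply/eqP/row_matrixP => i.
  rewrite row0; set v := row i _.
  have : v *m M = 0 by rewrite /v -row_mul mulmx_ker row0.
  rewrite -[v]vec_mxK ME => /eqP; rewrite mxvec_eq0 subr_eq0 => /eqP vE.
  suff -> : vec_mx v = 0 by rewrite linear0.
  by apply: (@lyapunov_unique _ _ 0); rewrite ?addr0 // mulmx0 mul0mx.
exists (vec_mx (mxvec Q *m invmx M)); set X := vec_mx _.
have : mxvec X *m M = mxvec Q by rewrite vec_mxK mulmxKV.
rewrite ME => /(can_inj mxvecK) <-.
by rewrite addrC subrK.
Qed.

(** Symmetry: X^T solves the same equation. Positivity: u^T X u dominates the remainder term of
    [lyapunov_iter] for every k, and that term tends to 0. *)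
Lemma lyapunov_psd (X Q : 'M[R]_n) :
  psdmx Q -> X = A^T *m X *m A + Q -> psdmx X.
Proof.
move=> [Qs Q0] XE; split.
  apply: (@lyapunov_unique _ _ Q) => //.
  by rewrite {1}XE linearD /= !trmx_mul trmxK Qs mulmxA.
move=> u.
have c0 : (fun k => (u^T *m ((A ^+ k)^T *m X *m A ^+ k) *m u) 0 0) @ \oo
    --> (0 : R).
  have := cvg_entries_mul (cvg_entries_mul (@cvg_entries_cst R _ _ u^T)
    (@powers_vanish_congr X)) (@cvg_entries_cst R _ _ u).
  by rewrite mulmx0 mul0mx => /(_ 0 0); rewrite [X in _ --> X]mxE.
rewrite -(cvg_lim _ c0) //; apply: limr_le; first by apply: cvgP c0.
near=> k; rewrite [in leRHS](lyapunov_iter k XE) mulmxDr mulmxDl.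
rewrite [leRHS]mxE lerDl.
rewrite mulmx_sumr mulmx_suml summxE sumr_ge0 // => l _.
have := Q0 (A ^+ l *m u); by rewrite trmx_mul !mulmxA.
Unshelve. all: by end_near.
Qed.

(** A row v of the kernel satisfies v = v A^k for all k, so v is its own limit 0. *)
Lemma sub1_unitmx : 1%:M - A \in unitmx.
Proof.
rewrite -row_free_unit -kermx_eq0; apply/eqP/row_matrixP => i.
rewrite row0; set v := row i _.
have /eqP : v *m (1%:M - A) = 0 by rewrite /v -row_mul mulmx_ker row0.
rewrite mulmxBr mulmx1 subr_eq0 => /eqP vA1.
have vE : (fun k => v *m A ^+ k) = (fun=> v).
  apply/funext; elim=> [|k IH]; first by rewrite expr0 mulmx1.
  by rewrite exprS -mulmxE mulmxA -vA1.
apply: (@cvg_entries_unique _ _ _ (fun k => v *m A ^+ k)).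
  by rewrite vE; exact: cvg_entries_cst.
by rewrite -(mulmx0 _ v); exact: cvg_entries_mul (@cvg_entries_cst R _ _ v) vA.
Qed.

End Lyapunov.

Lemma sqnorm2E (R : realType) m (v : 'cV[R]_m) : sqnorm2 v = (v^T *m v) 0 0.
Proof. by rewrite mxE; apply: eq_bigr => i _; rewrite mxE expr2. Qed.

Lemma mulmx_cV_sym (R : realType) m (u v : 'cV[R]_m) :
  (u^T *m v) 0 0 = (v^T *m u) 0 0.
Proof. by rewrite !mxE; apply: eq_bigr => i _; rewrite !mxE mulrC. Qed.

Lemma schur_stable_sub1_unitmx (R : realType) n (A : 'M[R]_n) :
  schur_stable A -> 1%:M - A \in unitmx.
Proof. by move=> /schur_stable_powers_vanish/sub1_unitmx. Qed.

Lemma entryD (R : nmodType) m n (A B : 'M[R]_(m, n)) i j :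
  (A + B) i j = A i j + B i j.
Proof. exact: mxE. Qed.

Lemma entryN (R : zmodType) m n (A : 'M[R]_(m, n)) i j : (- A) i j = - A i j.
Proof. exact: mxE. Qed.

Lemma dot_sub (R : pzRingType) m (u b c : 'cV[R]_m) :
  (u^T *m (b - c)) 0 0 = (u^T *m b) 0 0 - (u^T *m c) 0 0.
Proof. by rewrite mulmxBr entryD entryN. Qed.

Lemma sqnorm2_sub (R : realType) m (f g : 'cV[R]_m) :
  sqnorm2 (f - g) = sqnorm2 f - 2 * (g^T *m f) 0 0 + sqnorm2 g.
Proof.
have fg : (f^T *m g) 0 0 = (g^T *m f) 0 0 := mulmx_cV_sym _ _.
rewrite !sqnorm2E [(f - g)^T]linearB /= mulmxBl !mulmxBr !(entryD, entryN) fg.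
ring.
Qed.

(** * Algebra of the one-step drift *)

Section Drift.
Variables (R : realType) (n np nw ny : nat) (S : plant R n np nw ny).
Variables (muw : 'cV[R]_nw) (Sw : 'M[R]_nw) (ystar : 'cV[R]_ny).
Variable Zbar : 'M[R]_np.
Hypothesis Zbar_stable : schur_stable (Abar S Zbar).

Local Notation Ab := (Abar S Zbar).
Local Notation M := (Mbar S Zbar).
Local Notation Cy := (mxCy S).
Local Notation Bu := (mxBu S).
Local Notation P := (Pbar S Zbar).
Local Notation L := (Lbar S muw ystar Zbar).
Local Notation mu := (mux S muw Zbar).

Lemma Pbar_spec : P^T = P /\ P = Ab^T *m P *m Ab + Cy^T *m Cy.
Proof.
have vA := schur_stable_powers_vanish Zbar_stable.
have [X XE] := lyapunov_solvable vA (Cy^T *m Cy).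
have Xpsd : psdmx X.
  apply: (lyapunov_psd vA) XE; split; first by rewrite trmx_mul trmxK.
  move=> u; have -> : u^T *m (Cy^T *m Cy) *m u = (Cy *m u)^T *m (Cy *m u).
    by rewrite trmx_mul !mulmxA.
  by rewrite -sqnorm2E sumr_ge0 // => i _; exact: sqr_ge0.
(* [xget] returns a solution rather than its default 0 because X is a witness. *)
have [[Ps _] PE] : psdmx P /\ 0 = Ab^T *m P *m Ab - P + Cy^T *m Cy.
  apply: (@xgetPex _ 0
    [set X | psdmx X /\ 0 = Ab^T *m X *m Ab - X + Cy^T *m Cy]).
  by exists X; split=> //; rewrite {2}XE opprD addrA subrr sub0r addNr.
by split=> //; move/(congr1 (+%R^~ P)): PE; rewrite /= add0r addrAC subrK.
Qed.

Lemma Sx_spec :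
  Sx S Sw Zbar = Ab *m Sx S Sw Zbar *m Ab^T + M *m Sw *m M^T.
Proof.
(* The covariance equation is the Lyapunov equation of the transposed matrix. *)
have vA := powers_vanish_tr (schur_stable_powers_vanish Zbar_stable).
have [X XE] := lyapunov_solvable vA (M *m Sw *m M^T).
rewrite trmxK in XE.
apply: (@xgetPex _ 0 [set X | X = Ab *m X *m Ab^T + M *m Sw *m M^T]).
by exists X.
Qed.

(** By both equations and cyclicity of the trace, tr(P (Sx - Ab Sx Ab^T)) = tr((P - Ab^T P Ab) Sx) =
    tr(Cy^T Cy Sx). *)
Lemma trace_duality :
  \tr (P *m M *m Sw *m M^T) = \tr (Cy *m Sx S Sw Zbar *m Cy^T).
Proof.
have [_ PE] := Pbar_spec.
have -> : P *m M *m Sw *m M^T = P *m (M *m Sw *m M^T) by rewrite !mulmxA.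
have -> : M *m Sw *m M^T = Sx S Sw Zbar - Ab *m Sx S Sw Zbar *m Ab^T.
  by rewrite {1}Sx_spec addrAC subrr add0r.
rewrite mulmxBr linearB /= {1}PE mulmxDl linearD /=.
rewrite [\tr (Cy *m _ *m _)]mxtrace_mulC !mulmxA.
rewrite [X in _ - X]mxtrace_mulC !mulmxA.
by rewrite addrAC subrr add0r.
Qed.

Lemma mux_fixpoint : mu = Ab *m mu + M *m muw.
Proof.
have := schur_stable_sub1_unitmx Zbar_stable => U.
have : (1%:M - Ab) *m mu = M *m muw by rewrite /mux -!mulmxA mulKVmx.
by rewrite mulmxBl mul1mx => <-; rewrite addrC subrK.
Qed.

(** This choice of L makes the drift of the linear term of V cancel the cross term between Cy e and
    the static offset in the output error. *)
Lemma Lbar_spec : L^T *m (Ab - 1%:M) = (ystar - Cy *m mu)^T *m Cy.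
Proof.
have U : Ab - 1%:M \in unitmx.
  by rewrite -opprB -scaleN1r unitmxZ ?unitrN1 // schur_stable_sub1_unitmx.
by rewrite /Lbar !trmx_mul !trmxK -!mulmxA mulVmx // mulmx1.
Qed.

Definition lyap (x : 'cV[R]_n) : R :=
  ((x - mu)^T *m P *m (x - mu)) 0 0 + 2 * (L^T *m (x - mu)) 0 0.

(** The mean over the noise of the next deviation from [mux]. The companion [drift_noise] is the
    gain on the centred noise, equal to Bw - Bu Z Dw. *)
Definition drift_mean (x : 'cV[R]_n) (Z : 'M[R]_np) : 'cV[R]_n :=
  Ab *m (x - mu) - Bu *m (Z - Zbar) *m (mxCv S *m x + mxDw S *m muw).

Definition drift_noise (Z : 'M[R]_np) : 'M[R]_(n, nw) :=
  M - Bu *m (Z - Zbar) *m mxDw S.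

Lemma next_state_dev (x : 'cV[R]_n) (Z : 'M[R]_np) (w : 'cV[R]_nw) :
  next_state S x (input S Z x w) w - mu =
  drift_mean x Z + drift_noise Z *m (w - muw).
Proof.
rewrite {1}mux_fixpoint /next_state /input /drift_mean /drift_noise /Mbar /Abar.
rewrite !(mulmxBl, mulmxBr, mulmxDl, mulmxDr, mulmxN, mulNmx, mulmxA).
rewrite !(opprB, opprD).
apply/matrixP => i j; rewrite !(entryD, entryN); ring.
Qed.

Hypothesis Sw_sym : Sw^T = Sw.

Local Notation W := (Wbar S Sw).
Local Notation G := (Gbar S Sw Zbar).
Local Notation Rb := (Rbar S Zbar).

(** Expand the quadratic in M - D with D = Bu dZ Dw. The two cross terms agree since P and Sw are
    symmetric and yield G; the D-D term yields W and R; the M-M term is [trace_duality]. *)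
Lemma trace_noise (Z : 'M[R]_np) (dZ := Z - Zbar) :
  \tr (P *m drift_noise Z *m Sw *m (drift_noise Z)^T) =
  \tr (Cy *m Sx S Sw Zbar *m Cy^T)
  + \tr (W *m dZ^T *m Rb *m dZ - 2 *: (G^T *m dZ)).
Proof.
have [Ps _] := Pbar_spec.
have E0 (D : 'M[R]_(n, nw)) :
    \tr (P *m D *m Sw *m M^T) = \tr (P *m M *m Sw *m D^T).
  rewrite -mxtrace_tr !trmx_mul !trmxK Ps Sw_sym !mulmxA.
  by rewrite mxtrace_mulC !mulmxA.
rewrite -trace_duality /drift_noise -/dZ; set D := Bu *m dZ *m mxDw S.
have -> X Y : P *m (X - Y) *m Sw *m (X - Y)^T =
    P *m X *m Sw *m X^T - P *m X *m Sw *m Y^T - P *m Y *m Sw *m X^T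
    + P *m Y *m Sw *m Y^T.
  apply/matrixP => i j.
  rewrite [(X - Y)^T]linearB /= !mulmxBr !mulmxBl.
  rewrite !(entryD, entryN); ring.
have E1 : \tr (P *m M *m Sw *m D^T) = \tr (G^T *m dZ).
  rewrite /D !trmx_mul !mulmxA mxtrace_mulC !mulmxA mxtrace_mulC.
  by rewrite -mxtrace_tr !trmx_mul !trmxK !mulmxA.
have E2 : \tr (P *m D *m Sw *m M^T) = \tr (G^T *m dZ).
  by rewrite E0 E1.
have E3 : \tr (P *m D *m Sw *m D^T) = \tr (W *m dZ^T *m Rb *m dZ).
  rewrite /D /Wbar /Rbar !trmx_mul !mulmxA.
  by do 5!rewrite [LHS]mxtrace_mulC !mulmxA.
rewrite !mxtraceD ![\tr (- _)]linearN /= mxtraceZ E1 E2 E3; ring.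
Qed.

Lemma quad_sub (b c : 'cV[R]_n) : ((b - c)^T *m P *m (b - c)) 0 0 =
  (b^T *m P *m b) 0 0 - 2 * (b^T *m P *m c) 0 0 + (c^T *m P *m c) 0 0.
Proof.
have [Ps _] := Pbar_spec.
have cPb : (c^T *m P *m b) 0 0 = (b^T *m P *m c) 0 0.
  by rewrite -mulmxA mulmx_cV_sym trmx_mul Ps.
rewrite [(b - c)^T]linearB /= !mulmxBl !mulmxBr !(entryD, entryN) cPb; ring.
Qed.

(** Write a = Ab e - c with c = Bu dZ q. The terms in e alone rebuild V(x) minus the output error
    plus the static offset, by the equations of P and L; those in c give the q-part of [phi];
    [trace_noise] supplies the remaining traces. *)
Lemma drift_identity (x : 'cV[R]_n) (Z : 'M[R]_np)
    (a := drift_mean x Z) (N := drift_noise Z) :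
  (a^T *m P *m a) 0 0 + 2 * (L^T *m a) 0 0 + \tr (P *m N *m Sw *m N^T) =
  lyap x - sqnorm2 (Cy *m x - ystar) + static_perf S muw Sw ystar Zbar
  + phi S muw Sw ystar Zbar x Z.
Proof.
have [Ps PE] := Pbar_spec.
rewrite /N trace_noise /static_perf /phi /lyap /a /drift_mean.
set e := x - mu; set dZ := Z - Zbar.
set q := mxCv S *m x + mxDw S *m muw; set c := Bu *m dZ *m q.
rewrite quad_sub [(L^T *m _) 0 0](dot_sub L (Ab *m e) c).
have cPc : (q^T *m dZ^T *m Rb *m dZ *m q) 0 0 = (c^T *m P *m c) 0 0.
  by rewrite /c /Rbar !trmx_mul !mulmxA.
have rq : ((Fbar S Zbar *m e + Bu^T *m L)^T *m dZ *m q) 0 0 =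
    ((Ab *m e)^T *m P *m c) 0 0 + (L^T *m c) 0 0.
  rewrite [(_ + _)^T]linearD /= mulmxDl [in LHS]mulmxDl entryD.
  by rewrite /Fbar !trmx_mul !trmxK Ps /c !mulmxA.
have bPb : ((Ab *m e)^T *m P *m (Ab *m e)) 0 0 =
    (e^T *m P *m e) 0 0 - sqnorm2 (Cy *m e).
  rewrite sqnorm2E -entryN -entryD {2}PE !trmx_mul mulmxDr mulmxDl.
  by rewrite !mulmxA addrK.
have Lb : (L^T *m (Ab *m e)) 0 0 =
    (L^T *m e) 0 0 + ((ystar - Cy *m mu)^T *m (Cy *m e)) 0 0.
  have LAb : L^T *m Ab = L^T + (ystar - Cy *m mu)^T *m Cy.
    by rewrite -Lbar_spec (mulmxBr L^T Ab 1%:M) mulmx1 addrC subrK.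
  by rewrite mulmxA LAb mulmxDl entryD mulmxA.
have yE : sqnorm2 (Cy *m x - ystar) = sqnorm2 (Cy *m e)
    - 2 * ((ystar - Cy *m mu)^T *m (Cy *m e)) 0 0 + sqnorm2 (Cy *m mu - ystar).
  have -> : Cy *m x - ystar = Cy *m e - (ystar - Cy *m mu).
    by rewrite /e mulmxBr opprB addrA subrK.
  rewrite sqnorm2_sub; congr (_ + _); rewrite -opprB.
  by apply: eq_bigr => i _; rewrite [in LHS]entryN sqrrN.
rewrite cPc rq bPb Lb yE; ring.
Qed.

End Drift.

(** * Fubini's theorem for an independent pair *)

Section IndependentPair.
Context d d1 d2 (T : measurableType d) (T1 : measurableType d1)
  (T2 : measurableType d2) (R : realType) (P : probability T R).
Variables (X : {RV P >-> T1}) (Y : {RV P >-> T2}).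
Hypothesis XY_indep : forall A B, measurable A -> measurable B ->
  P (X @^-1` A `&` Y @^-1` B) = (P (X @^-1` A) * P (Y @^-1` B))%E.

Let XY t := (X t, Y t).

Let XY_measurable : measurable_fun setT XY.
Proof. exact: measurable_fun_pair. Qed.

#[local] HB.instance Definition _ :=
  isMeasurableFun.Build _ _ T (T1 * T2)%type XY XY_measurable.

(** Measurable rectangles determine the product measure, so independence identifies the joint law
    with it. *)
Let distribution_XY C : measurable C ->
  (distribution P X \x distribution P Y)%E C = distribution P XY C.
Proof. by apply: product_measure_unique => A B mA mB; exact: XY_indep. Qed.

Lemma integral_indep_pair (f : T1 * T2 -> \bar R) :
  measurable_fun setT f -> P.-integrable setT (fun t => f (X t, Y t)) ->
  P.-integrable setT (fun t => \int[P]_s f (X t, Y s))%E /\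
  (\int[P]_t f (X t, Y t) = \int[P]_t \int[P]_s f (X t, Y s))%E.
Proof.
move=> mf fi; pose m1 := distribution P X; pose m2 := distribution P Y.
have eq_int (g : T1 * T2 -> \bar R) :
    (\int[m1 \x m2]_z g z = \int[distribution P XY]_z g z)%E.
  by apply: eq_measure_integral => C mC _; exact: distribution_XY.
have fi2 : (m1 \x m2)%E.-integrable setT f.
  have /integrableP[_ ffin] :=
    integrable_pushforward XY_measurable mf fi measurableT.
  by apply/integrableP; split=> //; rewrite eq_int.
(* The inner Fubini integral over the law of Y, pulled back to the sample space with the first
   coordinate frozen at [X t]. *)
have FE : fubini_F m2 f \o X = (fun t => \int[P]_s f (X t, Y s))%E.
  apply/funext => t; rewrite /= /fubini_F.
  (* Splitting f avoids asking f (X t, _) to be integrable for every t. *)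
  have mft : measurable_fun setT (fun y => f (X t, y)).
    exact: measurableT_comp mf (pair1_measurable _).
  rewrite integralE [RHS]integralE.
  rewrite (ge0_integral_distribution Y (measurable_funepos mft)); last first.
    by move=> y; exact: funepos_ge0.
  rewrite (ge0_integral_distribution Y (measurable_funeneg mft)); last first.
    by move=> y; exact: funeneg_ge0.
  by congr (_ - _)%E; apply: eq_integral => s _; rewrite /= unlock.
have Fi : P.-integrable setT (fubini_F m2 f \o X).
  have mF := measurable_fubini_F fi2.
  have /integrableP[_ Ffin] := integrable_fubini_F fi2.
  apply/integrableP; split; first exact: measurableT_comp.
  rewrite ge0_integral_distribution // in Ffin.
  exact: measurableT_comp.
rewrite -FE; split=> //.
rewrite -(integral_distribution (measurable_fubini_F fi2) Fi).
rewrite integral12_prod_meas1 // eq_int.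
by rewrite integral_distribution.
Qed.

End IndependentPair.

(** * Expectations of quadratic forms *)

Section HasExpectation.
Context d (T : measurableType d) (R : realType) (P : probability T R).

(** Bundling integrability with the value lets linearity be applied without side conditions. *)
Definition has_expectation (f : T -> R) (c : R) :=
  P.-integrable setT (EFin \o f) /\ (\int[P]_t (f t)%:E)%E = c%:E.

Lemma has_expectation_cst c : has_expectation (fun=> c) c.
Proof.
split; first exact: (finite_measure_integrable_cst P c measurableT).
by rewrite -[RHS]mule1 -(probability_setT P); exact: integral_cst.
Qed.

Lemma has_expectationD f g a b : has_expectation f a -> has_expectation g b ->
  has_expectation (fun t => f t + g t) (a + b).
Proof.
move=> [fi fa] [gi gb]; split; first exact: (integrableD measurableT fi gi).
by under eq_integral do rewrite EFinD; rewrite integralD // fa gb.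
Qed.

Lemma has_expectationZ f a k : has_expectation f a ->
  has_expectation (fun t => k * f t) (k * a).
Proof.
move=> [fi fa]; split; first exact: (integrableZl measurableT k fi).
by under eq_integral do rewrite EFinM; rewrite integralZl // fa.
Qed.

Lemma has_expectation_sum (I : finType) (f : I -> T -> R) (a : I -> R) :
  (forall i, has_expectation (f i) (a i)) ->
  has_expectation (fun t => \sum_i f i t) (\sum_i a i).
Proof.
move=> fa; elim: (index_enum I) => [|i s IH].
  rewrite big_nil; under eq_fun do rewrite big_nil; exact: has_expectation_cst.
rewrite big_cons; under eq_fun do rewrite big_cons.
exact: has_expectationD.
Qed.

Lemma integrable_has_expectation f : P.-integrable setT (EFin \o f) ->
  has_expectation f (fine (\int[P]_t (f t)%:E)).
Proof. by move=> fi; split=> //; rewrite fineK // integrable_fin_num. Qed.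

(** Here S collects the uncentred second moments, and tr(Q S^T) is the entrywise pairing of Q and S,
    so linearity over the entries suffices. *)
Lemma has_expectation_quad m (Y : T -> 'cV[R]_m) (mu : 'cV[R]_m)
    (S Q : 'M[R]_m) (l : 'rV[R]_m) (c : R) :
  (forall i, has_expectation (fun t => Y t i 0) (mu i 0)) ->
  (forall i j, has_expectation (fun t => Y t i 0 * Y t j 0) (S i j)) ->
  has_expectation
    (fun t => ((Y t)^T *m Q *m Y t) 0 0 + (l *m Y t) 0 0 + c)
    (\tr (Q *m S^T) + (l *m mu) 0 0 + c).
Proof.
move=> Emu ES; apply: has_expectationD; last exact: has_expectation_cst.
apply: has_expectationD; last first.
  under eq_fun do rewrite mxE.
  by rewrite mxE; apply: has_expectation_sum => i; exact: has_expectationZ.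
have -> : \tr (Q *m S^T) = \sum_i \sum_j Q i j * S i j.
  by apply: eq_bigr => i _; rewrite mxE; apply: eq_bigr => j _; rewrite mxE.
rewrite (_ : (fun t => _) =
    (fun t => \sum_i \sum_j Q i j * (Y t i 0 * Y t j 0))); last first.
  apply/funext => t; rewrite -mulmxA mxE; apply: eq_bigr => i _.
  rewrite !mxE mulr_sumr; apply: eq_bigr => j _.
  by rewrite mulrCA.
apply: has_expectation_sum => i; apply: has_expectation_sum => j.
exact: has_expectationZ.
Qed.

End HasExpectation.

(** * Measurability of matrix-valued maps, entry by entry *)

Section MatrixMeasurability.
Context d (T : measurableType d) (R : realType).

Definition measurable_entries m n (f : T -> 'M[R]_(m, n)) :=
  forall i j, measurable_fun setT (fun t => f t i j).

Lemma measurable_entries_mfun m n (f : T -> 'M[R]_(m, n)) :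
  measurable_fun setT f -> measurable_entries f.
Proof.
move=> mf i j.
apply: (measurableT_comp (f := fun A : 'M[R]_(m, n) => A i j)) mf.
move=> _ B mB; rewrite setTI; apply: sub_sigma_algebra.
by exists (i, j) => //; exists B => //; rewrite setTI.
Qed.

Lemma measurable_entries_cst m n (A : 'M[R]_(m, n)) :
  measurable_entries (fun=> A).
Proof. by move=> i j; exact: measurable_cst. Qed.

Lemma measurable_entriesD m n (f g : T -> 'M[R]_(m, n)) :
  measurable_entries f -> measurable_entries g ->
  measurable_entries (fun t => f t + g t).
Proof.
by move=> mf mg i j; under eq_fun do rewrite mxE; exact: measurable_funD.
Qed.

Lemma measurable_entriesN m n (f : T -> 'M[R]_(m, n)) :
  measurable_entries f -> measurable_entries (fun t => - f t).
Proof.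
move=> mf i j; under eq_fun do rewrite mxE.
exact: measurableT_comp (mf i j).
Qed.

Lemma measurable_entriesM m n p
    (f : T -> 'M[R]_(m, n)) (g : T -> 'M[R]_(n, p)) :
  measurable_entries f -> measurable_entries g ->
  measurable_entries (fun t => f t *m g t).
Proof.
move=> mf mg i j; under eq_fun do rewrite mxE.
by apply: measurable_sum => l; exact: measurable_funM.
Qed.

Lemma measurable_entries_tr m n (f : T -> 'M[R]_(m, n)) :
  measurable_entries f -> measurable_entries (fun t => (f t)^T).
Proof. by move=> mf i j; under eq_fun do rewrite mxE; exact: mf. Qed.

End MatrixMeasurability.

(** * Integrability and moments of square integrable vectors *)

Section Moments.
Context d (T : measurableType d) (R : realType) (P : probability T R).

Lemma Lfun2_integrable (f : T -> R) : f \in Lfun P 2%:E ->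
  P.-integrable setT (EFin \o f).
Proof.
move=> f2; apply/Lfun1_integrable/Lfun_subset12 => //.
exact: fin_num_measure.
Qed.

Lemma Lfun2_subc (f : T -> R) c : f \in Lfun P 2%:E ->
  (fun t => f t - c) \in Lfun P 2%:E.
Proof.
move=> f2; have -> : (fun t => f t - c) = f - cst c by [].
by rewrite rpredB ?lee1n //= => _; exact: Lfun_cst.
Qed.

Lemma integrable_quad m (Y : T -> 'cV[R]_m)
    (Q : 'M[R]_m) (l : 'rV[R]_m) (c : R) :
  (forall i, (fun t => Y t i 0) \in Lfun P 2%:E) ->
  P.-integrable setT
    (EFin \o (fun t => ((Y t)^T *m Q *m Y t) 0 0 + (l *m Y t) 0 0 + c)).
Proof.
move=> Y2.
(* The actual moments serve as values; only the integrability half is kept. *)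
pose mu := \col_i fine (\int[P]_t (Y t i 0)%:E)%E.
pose S := \matrix_(i, j) fine (\int[P]_t (Y t i 0 * Y t j 0)%:E)%E.
apply: (proj1 (has_expectation_quad (mu := mu) (S := S) Q l c _ _)) => [i|i j].
  by rewrite mxE; apply: integrable_has_expectation; exact: Lfun2_integrable.
rewrite mxE; apply: integrable_has_expectation; apply/Lfun1_integrable.
exact: Lfun2_mul_Lfun1.
Qed.

(** Centring kills the linear term and turns the second moments into the covariance. *)
Lemma has_mean_cov_centered m (X : {RV P >-> 'cV[R]_m}) (mu : 'cV[R]_m)
    (S Q : 'M[R]_m) (l : 'rV[R]_m) (c : R) : has_mean_cov X mu S ->
  has_expectation P (fun t => ((X t - mu)^T *m Q *m (X t - mu)) 0 0
    + (l *m (X t - mu)) 0 0 + c) (\tr (Q *m S^T) + c).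
Proof.
move=> [X2 Xmu XS].
have -> : \tr (Q *m S^T) + c = \tr (Q *m S^T) + (l *m (0 : 'cV_m)) 0 0 + c.
  by rewrite mulmx0 mxE addr0.
apply: has_expectation_quad => [i|i j].
  rewrite mxE -(subrr (mu i 0)); under eq_fun do rewrite !mxE.
  apply: has_expectationD; last exact: has_expectation_cst.
  by split; [exact: Lfun2_integrable | rewrite -Xmu unlock].
split.
  apply/Lfun1_integrable; apply: Lfun2_mul_Lfun1.
    by under eq_fun do rewrite !mxE; exact: Lfun2_subc.
  by under eq_fun do rewrite !mxE; exact: Lfun2_subc.
rewrite -XS covariance.unlock !Xmu expectation.unlock.
by apply: eq_integral => t _; rewrite !mxE.
Qed.

End Moments.

(** * Stationary performance of the closed loop *)

Section ClosedLoop.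
Variables (R : realType) (n np nw ny : nat) (S : plant R n np nw ny).
Variables (muw : 'cV[R]_nw) (Sw : 'M[R]_nw) (ystar : 'cV[R]_ny).
Variable Zbar : 'M[R]_np.
Hypothesis Zbar_stable : schur_stable (Abar S Zbar).
Hypothesis Sw_sym : Sw^T = Sw.
Context d (T : measurableType d) (P : probability T R).

Local Notation P0 := (Pbar S Zbar).
Local Notation L := (Lbar S muw ystar Zbar).
Local Notation mu := (mux S muw Zbar).
Local Notation V := (lyap S muw ystar Zbar).

Lemma phi_static (x : 'cV[R]_n) : phi S muw Sw ystar Zbar x Zbar = 0.
Proof.
by rewrite /phi subrr !(trmx0, mulmx0, mul0mx) scaler0 subr0 mxtrace0 mxE
  mulr0 subr0 addr0.
Qed.

(** Sorts V by degree in the noise u, the shape that [has_mean_cov_centered] expects. *)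
Lemma lyap_affine m (a : 'cV[R]_n) (N : 'M[R]_(n, m)) (u : 'cV[R]_m)
    (e := a + N *m u) :
  (e^T *m P0 *m e) 0 0 + 2 * (L^T *m e) 0 0 =
  (u^T *m (N^T *m P0 *m N) *m u) 0 0
  + ((2 *: (a^T *m P0 *m N + L^T *m N)) *m u) 0 0
  + ((a^T *m P0 *m a) 0 0 + 2 * (L^T *m a) 0 0).
Proof.
rewrite /e -[N *m u]opprK (quad_sub Zbar_stable) dot_sub.
have -> : ((2 *: (a^T *m P0 *m N + L^T *m N)) *m u) 0 0 =
    2 * (a^T *m P0 *m (N *m u)) 0 0 + 2 * (L^T *m (N *m u)) 0 0.
  by rewrite -scalemxAl mxE mulmxDl mxE !mulmxA mulrDr.
have -> : (u^T *m (N^T *m P0 *m N) *m u) 0 0 =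
    ((N *m u)^T *m P0 *m (N *m u)) 0 0.
  by rewrite trmx_mul !mulmxA.
rewrite [(- _)^T]linearN /= !(mulmxN, mulNmx) !entryN; ring.
Qed.

(** State and gain are frozen here, so this is the conditional drift for a given state. *)
Lemma lyap_next_expectation (w : {RV P >-> 'cV[R]_nw}) (x : 'cV[R]_n)
    (Z : 'M[R]_np) : has_mean_cov w muw Sw ->
  has_expectation P (fun t => V (next_state S x (input S Z x (w t)) (w t)))
    (V x - sqnorm2 (mxCy S *m x - ystar) + static_perf S muw Sw ystar Zbar
     + phi S muw Sw ystar Zbar x Z).
Proof.
move=> wE.
rewrite -drift_identity // addrC; set N := drift_noise S Zbar Z.
have -> : \tr (P0 *m N *m Sw *m N^T) = \tr (N^T *m P0 *m N *m Sw^T).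
  by rewrite Sw_sym mxtrace_mulC !mulmxA.
under eq_fun do rewrite /lyap next_state_dev // lyap_affine.
exact: has_mean_cov_centered.
Qed.

Lemma lyap_integrable (X : T -> 'cV[R]_n) :
  (forall i, (fun t => X t i 0) \in Lfun P 2%:E) ->
  P.-integrable setT (EFin \o (V \o X)).
Proof.
move=> X2.
have -> : V \o X = (fun t => ((X t - mu)^T *m P0 *m (X t - mu)) 0 0
    + ((2 *: L^T) *m (X t - mu)) 0 0 + 0).
  by apply/funext => t; rewrite /= /lyap addr0 -scalemxAl [X in _ = _ + X]mxE.
apply: integrable_quad => i; under eq_fun do rewrite !mxE; exact: Lfun2_subc.
Qed.

Lemma output_error_integrable (X : T -> 'cV[R]_n) :
  (forall i, (fun t => X t i 0) \in Lfun P 2%:E) ->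
  P.-integrable setT (EFin \o (fun t => sqnorm2 (mxCy S *m X t - ystar))).
Proof.
move=> X2; rewrite [X in EFin \o X](_ : _ =
  (fun t => ((X t)^T *m ((mxCy S)^T *m mxCy S) *m X t) 0 0
    + ((- 2 *: (ystar^T *m mxCy S)) *m X t) 0 0 + sqnorm2 ystar)).
  exact: integrable_quad.
apply/funext => t; rewrite sqnorm2_sub sqnorm2E trmx_mul !mulmxA.
by rewrite -scalemxAl [X in _ = _ + X + _]mxE mulNr.
Qed.

Variables (x : int -> {RV P >-> 'cV[R]_n}) (w : int -> {RV P >-> 'cV[R]_nw}).
Variable K : {mfun 'cV[R]_n >-> 'M[R]_np}.
Hypothesis w_mean_cov : forall k, has_mean_cov (w k) muw Sw.
Hypothesis w_indep : indep_of_past w x.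
Hypothesis x_dynamics : forall (k : int) (t : T),
     x (k + 1) t
     = next_state S (x k t) (input S (K (x k t)) (x k t) (w k t)) (w k t).
Hypothesis x_sqint : forall k, square_integrable (x k).
Hypothesis xZ_stationary : stationary_loop x K.

(** The domain is arbitrary so as to serve both the state space and the product of state and
    noise. *)
Lemma lyap_measurable d' (T' : measurableType d') (X : T' -> 'cV[R]_n) :
  measurable_entries X -> measurable_fun setT (V \o X).
Proof.
move=> mX; have m0 : measurable_entries (fun t => X t - mu).
  by apply: measurable_entriesD => //; exact: measurable_entries_cst.
apply: measurable_funD.
  apply: (measurable_entriesM _ m0).
  apply: (measurable_entriesM _ (measurable_entries_cst P0)).
  exact: measurable_entries_tr.
apply: measurable_funM => //.
exact: (measurable_entriesM (measurable_entries_cst L^T) m0).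
Qed.

Lemma next_state_measurable :
  measurable_entries (fun z : 'cV[R]_n * 'cV[R]_nw =>
    next_state S z.1 (input S (K z.1) z.1 z.2) z.2).
Proof.
have m1 : measurable_entries (fun z : 'cV[R]_n * 'cV[R]_nw => z.1).
  exact: (measurable_entries_mfun (@measurable_fst _ _ _ _)).
have m2 : measurable_entries (fun z : 'cV[R]_n * 'cV[R]_nw => z.2).
  exact: (measurable_entries_mfun (@measurable_snd _ _ _ _)).
have mK : measurable_entries (fun z : 'cV[R]_n * 'cV[R]_nw => K z.1).
  by apply: measurable_entries_mfun; exact: measurableT_comp.
have mC m p (A : 'M[R]_(m, p)) :
    measurable_entries (fun _ : 'cV[R]_n * 'cV[R]_nw => A).
  exact: measurable_entries_cst.
apply: measurable_entriesD; last exact: measurable_entriesM (mC _ _ _) m2.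
apply: measurable_entriesD; first exact: measurable_entriesM (mC _ _ _) m1.
apply: measurable_entriesM (mC _ _ _) _; apply: measurable_entriesN.
apply: measurable_entriesM mK _.
by apply: measurable_entriesD; exact: measurable_entriesM.
Qed.

Lemma lyap_stationary k l :
  (\int[P]_t (V (x k t))%:E = \int[P]_t (V (x l t))%:E)%E.
Proof.
have mV : measurable_fun setT (EFin \o V).
  apply/measurable_EFinP; apply: (lyap_measurable (X := idfun)).
  exact: (measurable_entries_mfun (measurable_id (D := setT))).
have E j : (\int[P]_t (V (x j t))%:E = \int[distribution P (x j)]_y (V y)%:E)%E.
  rewrite (integral_distribution mV) //.
  exact: lyap_integrable (x_sqint j).
rewrite !E; apply: eq_measure_integral => A mA _.
(* Leaving the gain coordinate free gives stationarity of the state alone, and the integral of V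
   depends only on that law. *)
have := @xZ_stationary k l (A `*` setT) (measurableX mA measurableT).
have S1 j : [set t | (A `*` [set: 'M[R]_np]) (x j t, K (x j t))] = x j @^-1` A.
  by apply/seteqP; split=> t //= [].
by rewrite !S1.
Qed.

Lemma stationary_perf_le k :
  (forall t, phi S muw Sw ystar Zbar (x k t) (K (x k t)) <= 0) ->
  ('E_P[fun t => sqnorm2 (mxCy S *m x k t - ystar)]
   <= (static_perf S muw Sw ystar Zbar)%:E)%E.
Proof.
move=> phi0; rewrite expectation.unlock.
(* The expectations v of V and j of the output error are finite reals, so v can be cancelled at the
   end. *)
have [VI VE] := integrable_has_expectation (lyap_integrable (x_sqint k)).
have := integrable_has_expectation (output_error_integrable (x_sqint k)).
set v := fine _ in VE; set j := fine _ => Ej; rewrite (proj2 Ej) lee_fin.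
pose f (z : 'cV[R]_n * 'cV[R]_nw) :=
  (V (next_state S z.1 (input S (K z.1) z.1 z.2) z.2))%:E.
have mf : measurable_fun setT f.
  apply/measurable_EFinP; exact: lyap_measurable next_state_measurable.
have fx : (fun t => f (x k t, w k t)) = EFin \o (V \o x (k + 1)).
  by apply/funext => t; rewrite /f /= -x_dynamics.
have fi : P.-integrable setT (fun t => f (x k t, w k t)).
  by rewrite fx; exact: (lyap_integrable (x_sqint (k + 1))).
(* An event of x_k alone belongs to the past up to k. *)
have ind A B : measurable A -> measurable B ->
    P (x k @^-1` A `&` w k @^-1` B) = (P (x k @^-1` A) * P (w k @^-1` B))%E.
  move=> mA mB; apply: w_indep => //; apply: sub_sigma_algebra.
  exists k; first exact: lexx.
  by exists A => //; rewrite setTI.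
have [gi] := integral_indep_pair ind mf fi.
pose h y := V y - sqnorm2 (mxCy S *m y - ystar)
  + static_perf S muw Sw ystar Zbar.
have gE : (fun t => \int[P]_s f (x k t, w k s))%E = (fun t =>
    (h (x k t) + phi S muw Sw ystar Zbar (x k t) (K (x k t)))%:E).
  apply/funext => t.
  exact: (proj2 (lyap_next_expectation (x k t) (K (x k t)) (w_mean_cov k))).
(* By stationarity the left side of Fubini's identity is again v, so v is the expectation of h plus
   [phi]. *)
rewrite fx (lyap_stationary (k + 1) k) VE => Ev.
have Eh : has_expectation P (h \o x k)
    (v - j + static_perf S muw Sw ystar Zbar).
  apply: has_expectationD; last exact: has_expectation_cst.
  rewrite -[- j]mulN1r; under eq_fun do rewrite -[- sqnorm2 _]mulN1r.
  by apply: has_expectationD => //; exact: has_expectationZ.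
(* Dropping the nonpositive [phi] bounds v by the expectation of h; cancelling v bounds j. *)
suff : (v%:E <= (v - j + static_perf S muw Sw ystar Zbar)%:E)%E.
  by rewrite lee_fin; lra.
rewrite Ev -(proj2 Eh); apply: le_integral => //; first exact: (proj1 Eh).
move=> t _; rewrite [leLHS](congr1 (fun F => F t) gE) lee_fin.
by rewrite gerDl.
Qed.

End ClosedLoop.

Unset Implicit Arguments.

Theorem mainTheorem2 (R : realType) (n np nw ny : nat)
  (S : plant R n np nw ny) (muw : 'cV[R]_nw) (Sw : 'M[R]_nw)
  (ystar : 'cV[R]_ny)
  (d : measure_display) (T : measurableType d) (P : probability T R)
  (w : int -> {RV P >-> 'cV[R]_nw}) (x : int -> {RV P >-> 'cV[R]_n})
  (K : {mfun 'cV[R]_n >-> 'M[R]_np}) (Zbar : 'M[R]_np)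
  (S_positive_real : positive_real S)
  (Sw_pd : pdmx Sw)
  (w_iid : iid w)
  (w_mean_cov : forall k, has_mean_cov (w k) muw Sw)
  (w_indep : indep_of_past w x)
  (Zbar_feasible : feasible S Zbar)
  (Zbar_stable : schur_stable (Abar S Zbar))
  (K_minimizes : forall (k : int) (t : T),
     minimizes (phi S muw Sw ystar Zbar (x k t)) (feasible S) (K (x k t)))
  (x_dynamics : forall (k : int) (t : T),
     x (k + 1) t
     = next_state S (x k t) (input S (K (x k t)) (x k t) (w k t)) (w k t))
  (x_sqint : forall k, square_integrable (x k))
  (xZ_stationary : stationary_loop x K) :
  let J k := 'E_P[fun t => (sqnorm2 (mxCy S *m x k t - ystar))%R]%E in
  [/\ forall k t, phi S muw Sw ystar Zbar (x k t) (K (x k t)) <= 0,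
      forall k, (J k <= (static_perf S muw Sw ystar Zbar)%:E)%E
    & static_optimal S muw Sw ystar Zbar ->
      forall k, (J k <= (static_perf S muw Sw ystar Zbar)%:E)%E].
Proof.
move=> J.
have phi_le0 k t : phi S muw Sw ystar Zbar (x k t) (K (x k t)) <= 0.
  rewrite -(phi_static S muw Sw ystar Zbar (x k t)).
  exact: (K_minimizes k t).2.
have J_le k : (J k <= (static_perf S muw Sw ystar Zbar)%:E)%E.
  by apply: (@stationary_perf_le _ _ _ _ _ _ muw Sw _ _ _ _ _ _ _ _ w K) => //;
    exact: Sw_pd.1.
by split.
Qed.
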